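(* Let $\mu\in\mathcal P$ and $n\in\mathbb N$. For every $x\in\Xi_n$ there exists a best $d_{\sf K}$-approximation of $\mu$, given $x$. Moreover, for $p\in\Pi_n$, the measure $\delta_x^p$ is a best $d_{\sf K}$-approximation of $\mu$, given $x$, if and only if, for every $j=0,\ldots,n$, $$x_j<x_{j+1}\ \Longrightarrow\ F_{\mu-}(x_{j+1})-{\sf K}^\bullet(x)\le P_j\le F_\mu(x_j)+{\sf K}^\bullet(x),$$ and in this case $d_{\sf K}(\mu,\delta_x^p)={\sf K}^\bullet(x)$.
   Context: $\mathbb I\subset\mathbb R$ is a compact interval with positive Lebesgue measure, and $\mathcal P$ is the set of all Borel probability measures on $\mathbb I$. For $\mu\in\mathcal P$, $F_\mu(x)=\mu(\{y\in\mathbb I:y\le x\})$ and $F_{\mu-}(x)=\lim_{\varepsilon\downarrow0}F_\mu(x-\varepsilon)$ for $x\in\mathbb R$, with $F_\mu(-\infty)=0$ and $F_{\mu-}(+\infty)=1$. The Kolmogorov distance is $d_{\sf K}(\mu,\nu)=\sup_{x\in\mathbb R}|F_\mu(x)-F_\nu(x)|$. For $n\in\mathbb N$: $\Xi_n=\{x\in\mathbb I^n:x_1\le\ldots\le x_n\}$, with $x_0:=-\infty$, $x_{n+1}:=+\infty$; $\Pi_n=\{p\in\mathbb R^n:p_j\ge0,\ \sum_{j=1}^np_j=1\}$, with $P_i=\sum_{j=1}^ip_j$ for $i=0,\ldots,n$ (so $P_0=0$, $P_n=1$); $\delta_x^p=\sum_{j=1}^np_j\delta_{x_j}$, where $\delta_a$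 is the Dirac measure at $a$. Given $x\in\Xi_n$, $\delta_x^p$ is a best $d_{\sf K}$-approximation of $\mu$, given $x$, if $d_{\sf K}(\mu,\delta_x^p)\le d_{\sf K}(\mu,\delta_x^q)$ for all $q\in\Pi_n$. For $x\in\Xi_n$, $${\sf K}^\bullet(x)=\max\Bigl\{F_{\mu-}(x_1),\ \tfrac12\max_{j=1}^{n-1}\bigl(F_{\mu-}(x_{j+1})-F_\mu(x_j)\bigr),\ 1-F_\mu(x_n)\Bigr\}$$ (the middle term being absent if $n=1$). *)

(* Defs.v *)
From HB Require Import structures.
From mathcomp Require Import all_boot all_order all_algebra.
From mathcomp Require Import all_classical all_reals all_analysis.
Set Implicit Arguments.
Unset Strict Implicit.
Unset Printing Implicit Defensive.
Import Order.TTheory GRing.Theory Num.Theory.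
Import numFieldNormedType.Exports.
Local Open Scope classical_set_scope.
Local Open Scope ring_scope.

(* Borel probability measures on the interval I are represented as Borel
   probability measures mu on R with mu I = 1. *)
Notation borel_prob R := (probability (measurableTypeR R) R).

Section kolmogorov_distance.
Context {R : realType} (I : set R).
Implicit Types mu nu : borel_prob R.

Definition df mu (x : R) : R := fine (mu [set y | I y /\ y <= x]).

Definition df_left mu (x : R) : R := lim (df mu y @[y --> x^'-]).

Definition edf mu (x : \bar R) : R :=
  match x with x%:E => df mu x | +oo%E => 1 | -oo%E => 0 end.

Definition edf_left mu (x : \bar R) : R :=
  match x with x%:E => df_left mu x | +oo%E => 1 | -oo%E => 0 end.

Definition dK mu nu : R := sup (range (fun x : R => `|df mu x - df nu x|)).

End kolmogorov_distance.

Definition Xi {R : realType} (I : set R) (n : nat) : set ('I_n -> R) :=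
  [set x | (forall i, I (x i)) /\
           (forall i j : 'I_n, (i <= j)%N -> x i <= x j)].
Arguments Xi {R} I n.

(* [ext x j] is x_j in the 1-based numbering, with x_0 = -oo and
   x_(n+1) = +oo; the entry x_j, 1 <= j <= n, is [x i] with i = j - 1. *)
Definition ext {R : realType} (n : nat) (x : 'I_n -> R) (j : nat) : \bar R :=
  if j is k.+1 then
    if insub k is Some i then (x i)%:E else +oo%E
  else -oo%E.

Record weights (R : realType) (n : nat) := Weights {
  weight :> 'I_n -> R;
  weight_ge0 : forall j, 0 <= weight j;
  weight_sum1 : \sum_(j < n) weight j = 1 }.

(* P_j = p_1 + ... + p_j in the 1-based numbering. *)
Definition psum {R : realType} (n : nat) (p : weights R n) (j : nat) : R :=
  \sum_(i < n | (i < j)%N) p i.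

Section discrete_probability.
Context {R : realType} (n : nat) (x : 'I_n -> R) (p : weights R n).

Definition delta (A : set (measurableTypeR R)) : \bar R :=
  (\sum_(j < n) (p j)%:E * \d_(x j) A)%E.

Let delta0 : delta set0 = 0%E.
Proof. by rewrite /delta big1 // => j _; rewrite measure0 mule0. Qed.

Let delta_ge0 A : (0 <= delta A)%E.
Proof.
by apply: sume_ge0 => j _; rewrite mule_ge0 ?lee_fin ?weight_ge0.
Qed.

Let delta_sigma_additive : semi_sigma_additive delta.
Proof.
pose m k : {measure set (measurableTypeR R) -> \bar R} :=
  if insub k is Some i then mscale (NngNum (weight_ge0 p i)) (dirac (x i : measurableTypeR R))
  else mzero.
have -> : delta = msum m n.
  apply/funext => A; rewrite /delta /msum; apply: eq_bigr => j _.
  by rewrite /m valK.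
exact: measure_semi_sigma_additive.
Qed.

HB.instance Definition _ :=
  isMeasure.Build _ _ _ delta delta0 delta_ge0 delta_sigma_additive.

Let delta_setT : delta setT = 1%E.
Proof.
rewrite /delta -(weight_sum1 p) -sumEFin; apply: eq_bigr => j _.
by rewrite diracT mule1.
Qed.

HB.instance Definition _ :=
  Measure_isProbability.Build _ _ _ delta delta_setT.

End discrete_probability.

Section best_approximation.
Context {R : realType} (I : set R) (mu : borel_prob R).
Context (n : nat) (x : 'I_n -> R).

Definition best_approx (p : weights R n) : Prop :=
  forall q : weights R n, dK I mu (delta x p) <= dK I mu (delta x q).

(* The first and last terms of the maximum form the initial value of the
   iterated maximum, which is empty when n = 1. *)
Definition Kbullet : R :=
  \big[Num.max / Num.max (edf_left I mu (ext x 1)) (1 - edf I mu (ext x n))]_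
    (1 <= j < n)
    (2^-1 * (edf_left I mu (ext x j.+1) - edf I mu (ext x j))).

End best_approximation.

(* Main.v *)
Require Import Defs.
From mathcomp Require Import all_boot all_order all_algebra.
From mathcomp Require Import all_classical all_reals all_analysis.
From mathcomp Require Import lra.
Import Order.TTheory GRing.Theory Num.Theory.
Import numFieldNormedType.Exports.
Local Open Scope classical_set_scope.
Local Open Scope ring_scope.

(** Write F for the distribution function of mu, G for its left limit and K for
    the number [Kbullet I mu x].  On each nonempty cell x_j <= y < x_(j+1) the
    distribution function of [delta x p] is the constant P_j, while F increases
    there from F(x_j) to, in the limit, G(x_(j+1)).  Hence the distance on that
    cell is governed by two numbers only, and [dK I mu (delta x p) <= c] says
    exactly that, for every nonempty cell,
    G(x_(j+1)) - c <= P_j <= F(x_j) + c  ([dK_delta_le]).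

    For such a P_j to exist at all, c must be at least half of
    G(x_(j+1)) - F(x_j); in the two outer cells P_0 = 0 and P_n = 1 are
    prescribed, so that c must be at least G(x_1) and 1 - F(x_n).  An empty
    cell adds only half of G(x_j) - F(x_j) <= 0 to the maximum K.  Together these bounds say
    K <= c, and therefore K is a lower bound for the distance
    ([Kbullet_le_dK]).

    Conversely, for c = K the lower ends G(x_(j+1)) - K of the admissible
    intervals are nondecreasing in j, so their positive parts are the partial sums
    of a weight vector once the last one is raised to 1.  This vector attains K
    ([dK_eq_Kbullet_exists]).  So K is the minimal distance, the best
    approximations are the p with [dK I mu (delta x p) <= K], and the cell
    criterion with c = K describes them. *)

(** * Distribution functions and their left limits *)

Section distribution_function.
Context {R : realType} (I : set R) (mI : measurable I).
Implicit Types mu nu : borel_prob R.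

Lemma measurable_df_set (y : R) : measurable (I `&` [set z : R | z <= y]).
Proof.
apply: measurableI => //.
by rewrite -set_itvNyc; exact: measurable_itv.
Qed.

Lemma df_fin_num mu (y : R) : mu [set z | I z /\ z <= y] \is a fin_num.
Proof. exact: (fin_num_measure mu _ (measurable_df_set y)). Qed.

Lemma df_ge0 mu y : 0 <= df I mu y.
Proof. by apply: fine_ge0; exact: measure_ge0. Qed.

Lemma df_le1 mu y : df I mu y <= 1.
Proof.
rewrite -lee_fin /df fineK ?df_fin_num//.
exact: (probability_le1 mu (measurable_df_set y)).
Qed.

Lemma df_homo mu : {homo df I mu : y z / y <= z}.
Proof.
move=> y z yz; apply: fine_le; rewrite ?df_fin_num//.
apply: le_measure; rewrite ?inE; [exact: measurable_df_set..|].
by move=> t [It ty]; split=> //; exact: le_trans yz.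
Qed.

Lemma df_left_is_cvg mu (b : R) : cvg (df I mu y @[y --> b^'-]).
Proof.
apply: nondecreasing_at_left_is_cvgr.
  by apply: nearW => z y t _ _; exact: df_homo.
by apply: nearW => z; exists 1 => _ [y _ <-]; exact: df_le1.
Qed.

Lemma df_le_left mu (y b : R) : y < b -> df I mu y <= df_left I mu b.
Proof.
move=> yb; apply: limr_ge; first exact: df_left_is_cvg.
near=> z; apply: df_homo; near: z; exact: nbhs_left_ge.
Unshelve. all: by end_near. Qed.

(** The left limit at [b] sees only the points y with a <= y < b, so a bound for F on
    that cell passes to it; [a] is extended so that the cell unbounded to the left
    is covered as well. *)
Lemma df_left_le mu (a : \bar R) (b c : R) : (a < b%:E)%E ->
  (forall y : R, (a <= y%:E)%E -> y < b -> df I mu y <= c) ->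
  df_left I mu b <= c.
Proof.
move=> ab H.
have a_le : \forall z \near b^'-, (a <= z%:E)%E.
  case: a ab {H} => [a||]; rewrite ?lte_fin //= => ab.
    by near=> z; rewrite lee_fin; near: z; exact: nbhs_left_ge.
  by apply: nearW => z; rewrite leNye.
apply: limr_le; first exact: df_left_is_cvg.
by near=> z; apply: H; near: z => //; exact: nbhs_left_lt.
Unshelve. all: by end_near. Qed.

Lemma df_left_le_df mu b : df_left I mu b <= df I mu b.
Proof.
by apply: (@df_left_le mu -oo%E); rewrite ?ltNyr// => y _ /ltW; exact: df_homo.
Qed.

Lemma edf_left_ge0 mu b : 0 <= edf_left I mu b.
Proof.
case: b => [b||] //=.
by apply: le_trans (df_ge0 mu (b - 1)) (df_le_left mu _ _ _); rewrite gtrBl.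
Qed.

Lemma edf_left_le1 mu b : edf_left I mu b <= 1.
Proof.
by case: b => [b||] //=; apply: le_trans (df_left_le_df _ _) (df_le1 _ _).
Qed.

Lemma edf_ge0 mu b : 0 <= edf I mu b.
Proof. by case: b => [b||] //=; exact: df_ge0. Qed.

Lemma edf_left_le_edf mu b : edf_left I mu b <= edf I mu b.
Proof. by case: b => [b||] //=; exact: df_left_le_df. Qed.

Lemma edf_left_homo mu (a b : \bar R) :
  (a <= b)%E -> edf_left I mu a <= edf_left I mu b.
Proof.
case: a => [a||]; case: b => [b||] //=; rewrite ?edf_left_ge0//.
- rewrite lee_fin le_eqVlt => /predU1P[->//|ab].
  exact: le_trans (df_left_le_df _ _) (df_le_left mu _ _ ab).
- by move=> _; exact: (edf_left_le1 mu a%:E).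
- by move=> _; exact: (edf_left_ge0 mu b%:E).
Qed.

Lemma edf_le_df mu (a : \bar R) (y : R) :
  (a <= y%:E)%E -> edf I mu a <= df I mu y.
Proof.
by case: a => [a||] //=; [rewrite lee_fin; exact: df_homo | rewrite df_ge0].
Qed.

Lemma df_le_edf_left mu (y : R) (b : \bar R) :
  (y%:E < b)%E -> df I mu y <= edf_left I mu b.
Proof.
by case: b => [b||] //=; [rewrite lte_fin; exact: df_le_left | rewrite df_le1].
Qed.

(** Differences of distribution functions lie in [-1, 1], so the supremum
    defining the distance is a genuine one and is bounded by [c] precisely when
    all its members are. *)
Lemma dK_le mu nu (c : R) :
  dK I mu nu <= c <-> forall y, `|df I mu y - df I nu y| <= c.
Proof.
split=> [le_c y|le_c]; last first.
  by apply: ge_sup; [exists `|df I mu 0 - df I nu 0|, 0 | move=> _ [y _ <-]].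
apply: le_trans le_c; apply: ub_le_sup; last by exists y.
exists 1 => _ [z _ <-]; rewrite ler_norml.
have := df_ge0 mu z; have := df_le1 mu z.
have := df_ge0 nu z; have := df_le1 nu z; lra.
Qed.

End distribution_function.

(** * Cells of the support points and partial sums of the weights *)

Section support_points.
Context {R : realType} {n : nat} (x : 'I_n -> R).

Lemma extS (i : 'I_n) : ext x i.+1 = (x i)%:E.
Proof. by rewrite /ext valK. Qed.

Lemma ext_oversize : ext x n.+1 = +oo%E.
Proof. by rewrite /ext insubN ?ltnn. Qed.

Lemma ext_lty (j : nat) : (j <= n)%N -> (ext x j < +oo)%E.
Proof.
by case: j => [|j] jn; rewrite ?ltNyr // (extS (Ordinal jn)) ltry.
Qed.

Lemma ext_homo : (forall i j : 'I_n, (i <= j)%N -> x i <= x j) ->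
  {homo ext x : i j / (i <= j)%N >-> (i <= j)%E}.
Proof.
move=> x_homo [|i] [|j] //; rewrite ?leNye // ltnS => ij.
have [jn|nj] := ltnP j n; last by rewrite [leRHS]/= insubN ?leey // -leqNgt.
have lt_in : (i < n)%N := leq_ltn_trans ij jn.
by rewrite (extS (Ordinal lt_in)) (extS (Ordinal jn)) lee_fin x_homo.
Qed.

(** The cells between consecutive extended points cover the line: take the least
    [j] whose right end lies beyond [y]. *)
Lemma ext_locate (y : R) :
  exists2 j, (j <= n)%N & (ext x j <= y%:E < ext x j.+1)%E.
Proof.
have exP : exists j, (y%:E < ext x j.+1)%E.
  by exists n; rewrite ext_oversize ltry.
exists (ex_minn exP); case: ex_minnP => m lt_y min_m.
  by rewrite min_m // ext_oversize ltry.
rewrite lt_y andbT; case: m {lt_y} min_m => [|m] min_m; first exact: leNye.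
by rewrite leNgt; apply/negP => /min_m; rewrite ltnn.
Qed.

Lemma psum0 (p : weights R n) : psum p 0 = 0.
Proof. by rewrite /psum big_pred0. Qed.

Lemma psum_full (p : weights R n) : psum p n = 1.
Proof.
by rewrite -(weight_sum1 p); apply: eq_bigl => i; rewrite ltn_ord.
Qed.

(** A best approximation is easier to describe by its partial sums than by its
    weights; the weights are the increments of the sequence. *)
Lemma weights_of_psum (Q : nat -> R) : Q 0%N = 0 -> Q n = 1 ->
  (forall j, (j < n)%N -> Q j <= Q j.+1) ->
  exists p : weights R n, forall j, (j <= n)%N -> psum p j = Q j.
Proof.
move=> Q0 Qn Q_homo; pose w (i : 'I_n) := Q i.+1 - Q i.
have w_ge0 i : 0 <= w i by rewrite subr_ge0 Q_homo.
have sum_w j : (j <= n)%N -> \sum_(i < n | (i < j)%N) w i = Q j.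
  move=> jn; rewrite -(big_ord_widen n (fun i => Q i.+1 - Q i) jn).
  by rewrite -(big_mkord xpredT (fun i => Q i.+1 - Q i)) telescope_sumr // Q0 subr0.
have w_sum1 : \sum_(i < n) w i = 1.
  by rewrite -Qn -(sum_w n) //; apply: eq_bigl => i; rewrite ltn_ord.
by exists (Weights w_ge0 w_sum1).
Qed.

(** If [y] lies in cell [j], then exactly the first [j] support points are at
    most [y]; repeated points cannot be separated by a nonempty cell. *)
Lemma df_delta (I : set R) (p : weights R n) (j : nat) (y : R) :
  Xi I n x -> (ext x j <= y%:E < ext x j.+1)%E ->
  df I (delta x p) y = psum p j.
Proof.
move=> [xI x_homo] /andP[le_y lt_y].
have le_xE i : (x i <= y) = (i < j)%N.
  (* x i is entry i.+1 of the extended family *)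
  rewrite -lee_fin -extS; have [ij|ji] := ltnP i j.
    by rewrite (le_trans _ le_y) // ext_homo.
  by apply/negbTE; rewrite -ltNge (lt_le_trans lt_y) // ext_homo.
rewrite /df /= /delta /psum.
rewrite [in RHS]big_mkcond -[RHS]/(fine (_%:E)) -sumEFin; congr fine.
apply: eq_bigr => i _; rewrite diracE -le_xE.
case: ifPn => [le_xi|/negP le_xi].
  by rewrite mem_set ?mule1.
by rewrite memNset ?mule0 // => -[].
Qed.

End support_points.

(** * The cell criterion and the minimal distance *)

Section approximation.
Context {R : realType} (I : set R) (mI : measurable I) (mu : borel_prob R).
Context {n : nat} (n_gt0 : (0 < n)%N) (x : 'I_n -> R) (x_Xi : Xi I n x).

(** On a cell F lies between F(x_j), attained at its left end, and the left limit
    G(x_(j+1)), approached at its right end, while the approximating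
    distribution function is constant; comparing at these two ends is therefore
    enough.  At the infinite ends the criterion only says [0 <= c], because
    P_0 = 0 and P_n = 1. *)
Lemma dK_delta_le (p : weights R n) (c : R) :
  dK I mu (delta x p) <= c <->
  (forall j : nat, (j <= n)%N -> (ext x j < ext x j.+1)%E ->
     edf_left I mu (ext x j.+1) - c <= psum p j /\
     psum p j <= edf I mu (ext x j) + c).
Proof.
rewrite dK_le //; split=> [le_c j jn ltx|band y]; last first.
  have [j jn yj] := ext_locate x y; rewrite (df_delta x I _ _ _ x_Xi yj).
  have /andP[ley lty] := yj.
  have [lo hi] := band _ jn (le_lt_trans ley lty).
  have := edf_le_df _ mI mu _ _ ley; have := df_le_edf_left _ mI mu _ _ lty.
  by rewrite ler_norml; lra.
have c_ge0 : 0 <= c := le_trans (normr_ge0 _) (le_c 0).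
split.
  move: jn; rewrite leq_eqVlt => /predU1P[->|jn].
    by rewrite ext_oversize psum_full /= gerBl.
  move: ltx; rewrite (extS x (Ordinal jn)) => ltx.
  rewrite lerBlDr; apply: df_left_le ltx _ => // y ley lty.
  have := le_c y; rewrite (df_delta x _ p j) //.
    by rewrite ler_norml; lra.
  by rewrite ley (extS x (Ordinal jn)) lte_fin.
case: j jn ltx => [|j] jn ltx; first by rewrite psum0 add0r.
move: (ltx); rewrite (extS x (Ordinal jn)) /= => ltx'.
have := le_c (x (Ordinal jn)); rewrite (df_delta x _ p j.+1) //.
  by rewrite ler_norml; lra.
by rewrite ltx' (extS x (Ordinal jn)) lexx.
Qed.

(** The middle terms are rearranged so as to say that the interval prescribed for
    P_j by the cell criterion is nonempty. *)
Lemma Kbullet_le (c : R) :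
  Kbullet I mu x <= c <->
  [/\ edf_left I mu (ext x 1) <= c, 1 - edf I mu (ext x n) <= c &
   forall j, (0 < j < n)%N ->
     edf_left I mu (ext x j.+1) - c <= edf I mu (ext x j) + c].
Proof.
split=> [le_c|[le1 len lej]].
  have := le_trans (bigmax_ge_id _ _ _ _) le_c.
  rewrite ge_max => /andP[-> ->]; split=> // j jn.
  have : j \in index_iota 1 n by rewrite mem_index_iota.
  move=> /(le_bigmax_seq (Num.max (edf_left I mu (ext x 1))
    (1 - edf I mu (ext x n))) _ xpredT) => /(_ (fun j =>
      2^-1 * (edf_left I mu (ext x j.+1) - edf I mu (ext x j))) isT).
  by move=> /le_trans /(_ le_c); lra.
rewrite /Kbullet big_seq; apply: bigmax_le => [|j].
  by rewrite ge_max le1.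
by rewrite mem_index_iota => /lej; lra.
Qed.

(** The cell criterion holds with [c] the distance itself.  It forces each term
    of the maximum to be at most [c], except the terms of empty cells
    x_j = x_(j+1); these are at most 0 since G <= F. *)
Lemma Kbullet_le_dK (p : weights R n) :
  Kbullet I mu x <= dK I mu (delta x p).
Proof.
have /dK_delta_le band := lexx (dK I mu (delta x p)).
set c := dK _ _ _ in band *.
have [_ x_homo] := x_Xi.
have c_ge0 : 0 <= c.
  have /dK_le h := lexx c.
  exact: le_trans (normr_ge0 _) (h mI 0).
apply/Kbullet_le; split.
- have [|lo _] := band 0%N (leq0n n); last by rewrite psum0 in lo; lra.
  by rewrite (extS x (Ordinal n_gt0)) ltNyr.
- have [|_] := band n (leqnn n); last by rewrite psum_full; lra.
  by rewrite ext_oversize ext_lty.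
- move=> j /andP[_ jn].
  have := ext_homo x x_homo _ _ (leqnSn j).
  rewrite le_eqVlt => /predU1P[<-|ltx].
    by have := edf_left_le_edf _ mI mu (ext x j); lra.
  by have [] := band j (ltnW jn) ltx; lra.
Qed.

(** The partial sums are taken as small as the criterion with c = K permits,
    namely P_j = max(0, G(x_(j+1)) - K) for j < n.  They are monotone because G is,
    P_0 vanishes because G(x_1) <= K, and P_n = 1 is admissible because
    1 - F(x_n) <= K. *)
Lemma dK_eq_Kbullet_exists :
  exists p : weights R n, dK I mu (delta x p) = Kbullet I mu x.
Proof.
have /Kbullet_le := lexx (Kbullet I mu x); set K := Kbullet I mu x.
move=> [le1 len lej]; have [_ x_homo] := x_Xi.
have K_ge0 : 0 <= K by exact: le_trans (edf_left_ge0 _ mI _ _) le1.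
pose Q j := if (j < n)%N then Num.max 0 (edf_left I mu (ext x j.+1) - K) else 1.
have Q_homo j : (j < n)%N -> Q j <= Q j.+1.
  move=> jn; rewrite /Q jn; case: ifP => _; rewrite ge_max.
    rewrite !le_max lexx lerD2r /= orbC edf_left_homo//.
    exact: ext_homo x x_homo _ _ (leqnSn _).
  by have := edf_left_le1 _ mI mu (ext x j.+1); lra.
have [||p pE] := weights_of_psum Q _ _ Q_homo.
- by rewrite /Q n_gt0; apply/max_idPl; lra.
- by rewrite /Q ltnn.
exists p; apply/eqP; rewrite eq_le Kbullet_le_dK andbT.
apply/dK_delta_le => j jn _; rewrite pE // /Q; case: ltnP => [lt_jn|n_le].
  rewrite le_max lexx orbT ge_max; split=> //; apply/andP; split.
    by have := edf_ge0 I mu (ext x j); lra.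
  case: j lt_jn {jn} => [|j] lt_jn; last exact: lej.
  by rewrite /=; lra.
have -> : j = n by apply/eqP; rewrite eqn_leq jn.
by rewrite ext_oversize /=; lra.
Qed.

End approximation.

Theorem theorem5p1 (R : realType) (I : set R)
    (I_compact : compact I) (I_interval : is_interval I)
    (I_pos : (0 < lebesgue_measure I)%E)
    (mu : borel_prob R) (mu_I : mu I = 1%E)
    (n : nat) (n_gt0 : (0 < n)%N)
    (x : 'I_n -> R) (x_Xi : Xi I n x) :
  (exists p : weights R n, best_approx I mu x p) /\
  (forall p : weights R n,
    (best_approx I mu x p <->
      (forall j : nat, (j <= n)%N -> (ext x j < ext x j.+1)%E ->
        edf_left I mu (ext x j.+1) - Kbullet I mu x <= psum p j /\
        psum p j <= edf I mu (ext x j) + Kbullet I mu x)) /\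
    (best_approx I mu x p -> dK I mu (delta x p) = Kbullet I mu x)).
Proof.
have mI : measurable I by exact: measurable_realfun.is_interval_measurable.
have [p0 p0K] := dK_eq_Kbullet_exists I mI mu n_gt0 x x_Xi.
have le_dK p : Kbullet I mu x <= dK I mu (delta x p).
  exact: Kbullet_le_dK.
have bestE p : best_approx I mu x p <-> dK I mu (delta x p) <= Kbullet I mu x.
  split=> [best|le_K q]; first by rewrite -p0K; exact: best.
  exact: le_trans le_K (le_dK q).
split; first by exists p0; apply/bestE; rewrite p0K.
move=> p; split; first by rewrite bestE; exact: dK_delta_le.
by move/bestE => le_K; apply/eqP; rewrite eq_le le_K le_dK.
Qed.
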